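(* Every Hausdorff cellular-Lindelöf space with a regular $G_\delta$-diagonal has cardinality at most $2^{\mathfrak{c}}$.
   Context: Here $\mathfrak{c}=2^{\aleph_0}$. A cellular family in a topological space $X$ is a family of pairwise disjoint non-empty open subsets of $X$. A space $X$ is called cellular-Lindelöf if for every cellular family $\mathcal{U}$ in $X$ there is a Lindelöf subspace $L$ of $X$ such that $U \cap L \neq \emptyset$ for every $U \in \mathcal{U}$. A space $X$ has a regular $G_\delta$-diagonal if there is a sequence $\{U_n : n<\omega\}$ of open subsets of $X^2$, each containing the diagonal $\Delta=\{(x,x):x\in X\}$, such that $\Delta=\bigcap_{n<\omega}\overline{U_n}$ (closures taken in $X^2$). *)

(* Defs.v *)
From mathcomp Require Import all_boot all_order all_algebra.
From mathcomp Require Import all_classical topology.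

Set Implicit Arguments.
Unset Strict Implicit.
Unset Printing Implicit Defensive.

Local Open Scope classical_set_scope.

(* No separation axiom is built into the Lindelof property. *)
Definition lindelof (X : topologicalType) : Prop :=
  forall C : set (set X),
    C `<=` open -> \bigcup_(A in C) A = [set: X] ->
    exists D : set (set X),
      [/\ D `<=` C, countable D & \bigcup_(A in D) A = [set: X]].

Definition cellular_family (X : topologicalType) (U : set (set X)) : Prop :=
  [/\ forall A, U A -> open A,
      forall A, U A -> A !=set0
    & trivIset U id].

(* The subspace on L is the type set_type L, which carries the topology induced
   by the inclusion; the library type subspace L is not used here, since its
   carrier is all of X, with the points outside L made isolated. *)
Definition cellular_lindelof (X : topologicalType) : Prop :=
  forall U : set (set X), cellular_family U ->
    exists L : set X,
      lindelof (set_type L) /\ forall A, U A -> A `&` L !=set0.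

Definition regular_Gdelta_diagonal (X : topologicalType) : Prop :=
  exists U : nat -> set (X * X),
    [/\ forall n, open (U n),
        forall n, diagonal `<=` U n
      & diagonal = \bigcap_n closure (U n)].

(* Main.v *)
Require Import Defs.
From mathcomp Require Import all_boot all_order all_algebra.
From mathcomp Require Import all_classical topology.

(* Write c = 2^aleph_0 and choose open N_n(x) containing x with N_n(x)^2 in U_n.

   A Lindelof subspace injects into the sequences of naturals: send x to the
   indices of the members containing it in countable subcovers of the N_n.
   Hence every cellular family of a cellular-Lindelof X has size at most c, and
   every family of open sets has a subfamily of size at most c with dense union.

   Let C_n(A) be the closure of the union of the N_n(a), a in A. Take Y of size at
   most 2^c reflecting points of X that satisfy certain conditions with parameters
   in the subsets of Y of size at most c. If p is not in Y and q is in Y, pick open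
   G containing q and H containing p with G x H disjoint from some U_n; every
   N_n(r) misses G or H. Covering densely the N_n(r), r in Y, that miss G (resp. H)
   by those with r in a small A (resp. B), all r in Y satisfy N_n(r) <= C_n(A) or
   N_n(r) <= C_n(B); by reflection so does p, whence N_n(p) <= C_n(A), while q is
   not in C_n(A). So Y is covered by the open sets ~C_n(A) disjoint from N_n(p), and
   for each n a small subfamily has a union T_n that is dense in theirs. The
   closures of the T_n cover Y, hence X by reflection, but p is in none of them. *)

Local Open Scope classical_set_scope.
Local Open Scope card_scope.

(** * Injections and sets of size at most the continuum *)

Lemma card_leTT_inj {T : Type} {U : pointedType} (f : T -> U) :
  injective f -> [set: T] #<= [set: U].
Proof. by move=> fI; apply/pcard_injP; exists f => x y _ _; exact: fI. Qed.

Lemma card_leTT_injP {T : Type} {U : pointedType} :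
  [set: T] #<= [set: U] -> exists f : T -> U, injective f.
Proof.
move/pcard_injP => [f fI]; exists f => x y; apply: fI; exact: mem_setT.
Qed.

(** An injection of [S] into [U] is inverted; [x0] fills the indices that no point of [S] uses. *)
Lemma card_le_enum {T : Type} {U : pointedType} (S : set T) (x0 : T) :
  S #<= [set: U] ->
  exists g : U -> T,
    (forall k, S (g k) \/ g k = x0) /\ forall x, S x -> exists k, g k = x.
Proof.
move=> /pcard_injP[f fI].
have /choice[g gP] : forall k, exists x, (S x /\ f x = k) \/
    (x = x0 /\ ~ exists y, S y /\ f y = k).
  move=> k; have [[x ?]|nx] := pselect (exists y, S y /\ f y = k).
    by exists x; left.
  by exists x0; right.
exists g; split=> [k|x Sx]; first by have [[]|[]] := gP k; [left|right].
exists (f x); have [[Sg gx]|[_ []]] := gP (f x); last by exists x.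
by apply: fI => //; exact: mem_set.
Qed.

Lemma image_injective {T U : Type} (f : T -> U) :
  injective f -> injective (image^~ f).
Proof.
by move=> fI A B /= /funeqP E; apply/funext => x; rewrite -(image_inj fI) E image_inj.
Qed.

Lemma card_set_count_le (T : countType) : [set: set T] #<= [set: set nat].
Proof.
exact: card_leTT_inj (image_injective _ (pcan_inj (@pickleK T))).
Qed.

Lemma card_count_le (T : countType) : [set: T] #<= [set: set nat].
Proof.
apply: card_le_trans (card_set_count_le T).
by apply: (@card_leTT_inj _ _ set1) => x y /seteqP[+ _] => /(_ x erefl).
Qed.

Lemma card_prod_le (T U : Type) :
  [set: T] #<= [set: set nat] -> [set: U] #<= [set: set nat] ->
  [set: T * U] #<= [set: set nat].
Proof.
move=> /card_leTT_injP[f fI] /card_leTT_injP[g gI].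
pose h (x : T * U) : set (nat + nat) :=
  [set n | match n with inl i => f x.1 i | inr j => g x.2 j end].
apply: card_le_trans (card_set_count_le _).
apply: (@card_leTT_inj _ _ h) => -[a b] [c d] /funeqP hE; congr pair.
- by apply: fI; apply/funext => i; exact: (hE (inl i)).
- by apply: gI; apply/funext => i; exact: (hE (inr i)).
Qed.

Lemma card_seq_le (T : Type) :
  [set: T] #<= [set: set nat] -> [set: seq T] #<= [set: set nat].
Proof.
move=> /card_leTT_injP[f fI].
(* The length is recorded because [nth] pads with [set0], which may also be a genuine entry. *)
pose h (s : seq T) : set (nat + nat * nat) :=
  [set n | match n with
           | inl i => i = size s
           | inr (i, j) => nth set0 [seq f x | x <- s] i j
           end].
apply: card_le_trans (card_set_count_le _).
apply: (@card_leTT_inj _ _ h) => s t /funeqP hE; apply: (inj_map fI).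
have st : size s = size t by rewrite -[_ = _](hE (inl (size s))).
apply: (@eq_from_nth _ set0); rewrite !size_map// => i _.
by apply/funext => j; exact: (hE (inr (i, j))).
Qed.

(** * Closure under infinitary partial operations, and reflection *)

Section Terms.
Context {X D I : Type} (F : I -> (D -> option X) -> option X).

Inductive term : Type := absent | apply_op of I & D -> term.

Fixpoint eval (t : term) : option X :=
  if t is apply_op i f then F i (fun d => eval (f d)) else None.

Fixpoint positions (t : term) : set (seq D * I) :=
  if t is apply_op i f then
    fun p => match p.1 with
             | [::] => p.2 = i
             | d :: s => positions (f d) (s, p.2)
             end
  else set0.

Lemma positions_inj : injective positions.
Proof.
elim=> [|i f IH] [|j g] //= /funeqP E.
- by have E0 : False = (j = j) := E ([::], j); exfalso; rewrite E0.
- by have E0 : (i = i) = False := E ([::], i); exfalso; rewrite -E0.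
- have := E ([::], i); rewrite /= => ij.
  have -> : i = j by rewrite -ij.
  congr apply_op; apply/funext => d; apply: IH; apply/funext => -[s k].
  exact: (E (d :: s, k)).
Qed.

(* The closed set consists of the values of infinitary terms; a term is well
   founded, hence determined by the set of its labelled positions, which are
   finite sequences of directions. *)
Lemma exists_closed_under_operations :
  [set: D] #<= [set: set nat] -> [set: I] #<= [set: set nat] ->
  exists Y : set X, Y #<= [set: set (set nat)] /\
    forall i g, (forall d x, g d = Some x -> Y x) ->
      forall x, F i g = Some x -> Y x.
Proof.
move=> Db Ib.
have [c cI] := card_leTT_injP (card_prod_le _ _ (card_seq_le _ Db) Ib).
exists [set x | exists t, eval t = Some x]; split.
- have /choice[t tP] : forall x, exists t,
      (exists t, eval t = Some x) -> eval t = Some x.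
    move=> x; have [[t tx]|nY] := pselect (exists t, eval t = Some x).
      by exists t.
    by exists absent.
  apply/pcard_injP; exists (fun x => c @` positions (t x)).
  move=> x y /set_mem Yx /set_mem Yy E.
  apply: Some_inj; rewrite -tP// -[RHS]tP//; congr eval.
  by apply: positions_inj; apply: image_injective E.
- move=> i g gY x Fx.
  have /choice[t tP] : forall d, exists t, eval t = g d.
    move=> d; case E : (g d) => [y|]; first exact: gY E.
    by exists absent.
  by exists (apply_op i t) => /=; rewrite -Fx; congr F; apply/funext.
Qed.

End Terms.

(** The operations are Skolem functions: each picks a point of [P i h] when there is one, so a set
    closed under them reflects. *)
Lemma exists_reflecting_set {X I J : Type} (P : I -> (J -> set X) -> set X) :
  [set: I] #<= [set: set nat] -> [set: J] #<= [set: set nat] ->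
  exists Y : set X, Y #<= [set: set (set nat)] /\
    forall i h, (forall j, h j `<=` Y /\ h j #<= [set: set nat]) ->
      P i h !=set0 -> P i h `&` Y !=set0.
Proof.
move=> Ib Jb.
pose family (g : J * set nat -> option X) j := [set x | exists k, g (j, k) = Some x].
have /choice[F FP] : forall ig : I * (J * set nat -> option X), exists o,
    P ig.1 (family ig.2) !=set0 -> exists2 x, o = Some x & P ig.1 (family ig.2) x.
  move=> [i g] /=; have [[x Px]|nP] := pselect (P i (family g) !=set0).
    by exists (Some x) => _; exists x.
  by exists None.
have [Y [Yb YF]] := exists_closed_under_operations (fun i g => F (i, g))
  (card_prod_le _ _ Jb (card_lexx _)) Ib.
exists Y; split=> // i h hY Ph0.
have /choice[f fP] : forall j, exists f : X -> set nat, {in h j &, injective f}.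
  by move=> j; apply/pcard_injP; have [] := hY j.
have /choice[g gP] : forall jk : J * set nat, exists o,
    forall x, o = Some x <-> h jk.1 x /\ f jk.1 x = jk.2.
  move=> [j k] /=; have [[y [hy fy]]|nx] := pselect (exists x, h j x /\ f j x = k).
    exists (Some y) => x; split=> [[<-]//|[hx fx]]; congr Some.
    by apply: (fP j); rewrite ?inE// fx.
  by exists None => x; split=> // hx; case: nx; exists x.
have hE : family g = h.
  apply/funext => j; apply/seteqP; split=> x /=; first by case=> k /gP[].
  by move=> hx; exists (f j x); apply/gP.
have [] := FP (i, g); rewrite /= hE// => x Fx Px.
exists x; split=> //; apply: (YF i g) Fx => -[j k] y /gP[/= hy _].
by have [+ _] := hY j; apply.
Qed.

(** * Consequences of small cellularity *)

Section CellularityContinuum.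
Context {X : topologicalType}.
Hypothesis cellX : forall U : set (set X), cellular_family U -> U #<= [set: set nat].

(** Take a maximal disjoint family of non-empty open sets, each inside some [O i], and keep one such
    [i] per member. *)
Lemma small_dense_subfamily {I : Type} (O : I -> set X) (R : set I) :
  (forall i, R i -> open (O i)) ->
  exists S : set I, [/\ S `<=` R, S #<= [set: set nat] &
    \bigcup_(i in R) O i `<=` closure (\bigcup_(i in S) O i)].
Proof.
move=> Oop; have [[i0 Ri0]|/nonemptyPn ->] := pselect (R !=set0); last first.
  by exists set0; split=> //; rewrite bigcup_set0.
pose D := [set V | [/\ open V, V !=set0 & exists i, R i /\ V `<=` O i]].
have [E [ED tE maxE]] := ex_maximal_disjoint_subcollection (@id (set X)) D.
have cE : cellular_family E by split=> // V /ED[].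
have /choice[s sP] : forall V, exists i, R i /\ (E V -> V `<=` O i).
  move=> V; have [/ED[_ _ [i [Ri Vi]]]|nE] := pselect (E V); first by exists i.
  by exists i0.
exists (s @` E); split.
- by move=> _ [V _ <-]; have [] := sP V.
- exact: card_le_trans (card_image_le _ _) (cellX _ cE).
- move=> x [i Ri Oix]; apply: contrapT => nx.
  set T := \bigcup_(j in _) _ in nx.
  (* [W] misses every member of [E], so adding it to [E] contradicts maximality. *)
  pose W := O i `&` ~` closure T.
  have DW : D W.
    split; last by exists i; split=> // y [].
      by apply: openI; [exact: Oop|exact/closed_openC/closed_closure].
    by exists x.
  have WE V : E V -> V `&` W = set0.
    move=> EV; rewrite -subset0 => y [Vy [_]]; apply; apply: subset_closure.
    by exists (s V); [exists V|have [_] := sP V; exact].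
  have nEW : ~ E W.
    by move=> /WE; rewrite setIid => W0; have [_ [y]] := DW; rewrite W0.
  apply: (maxE (E `|` [set W])).
  + split; first exact: subsetUl.
    by move=> /(_ W) EW; apply: nEW; apply: EW; right.
  + by move=> V [/ED//|->].
  + move=> V V' [EV|->] [EV'|->] //; first exact: tE.
      by rewrite WE//; case.
    by rewrite setIC WE//; case.
Qed.

End CellularityContinuum.

(** * Diagonal neighbourhoods and Lindelöf subspaces *)

Lemma open_diagonal_square {X : topologicalType} (U : set (X * X)) (x : X) :
  open U -> diagonal `<=` U ->
  exists V : set X, [/\ open V, V x & V `*` V `<=` U].
Proof.
move=> Uop dU.
have : nbhs (x, x) U by apply: open_nbhs_nbhs; split=> //; exact: dU.
move=> [[A B] /= [Ax Bx] AB].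
exists ((A `&` B)°); split.
- exact: open_interior.
- exact: filterI.
- move=> [y z] [/= /interior_subset[Ay _] /interior_subset[_ Bz]].
  exact: AB.
Qed.

Lemma nclosure_prod {X : topologicalType} (U : set (X * X)) (x y : X) :
  ~ closure U (x, y) ->
  exists G H : set X, [/\ open G, open H, G x, H y & G `*` H `&` U = set0].
Proof.
move=> nU.
have : nbhs (x, y) (~` closure U).
  by apply: open_nbhs_nbhs; split=> //; exact/closed_openC/closed_closure.
move=> [[A B] /= [Ax By] AB].
exists A°, B°; split=> //; try exact: open_interior.
rewrite -subset0 => -[a b] [[/= /interior_subset Aa /interior_subset Bb] Uab].
by apply: (AB (a, b)); [|exact: subset_closure].
Qed.

Lemma lindelof_card_le {X : topologicalType} (U : nat -> set (X * X)) (L : set X) :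
  (forall n, open (U n)) -> (forall n, diagonal `<=` U n) ->
  \bigcap_n U n `<=` diagonal ->
  lindelof (set_type L) -> L #<= [set: set nat].
Proof.
move=> Uop dU Ud lindL.
have /choice[N NP] : forall nx : nat * X, exists V : set X,
    [/\ open V, V nx.2 & V `*` V `<=` U nx.1].
  by move=> [n x]; exact: open_diagonal_square.
have /choice[D DP] : forall n, exists D : set (set (set_type L)),
    [/\ D `<=` [set set_val @^-1` N (n, set_val x) | x in [set: set_type L]],
      countable D & \bigcup_(A in D) A = [set: set_type L]].
  move=> n; apply: lindL.
  - move=> _ [x _ <-]; exists (N (n, set_val x)); last by [].
    by have [] := NP (n, set_val x).
  - rewrite -subTset => x _; exists (set_val @^-1` N (n, set_val x)); first by exists x.
    by have [] := NP (n, set_val x).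
have /choice[e eP] : forall n, exists f : set (set_type L) -> nat, {in D n &, injective f}.
  by move=> n; apply/pcard_injP; have [] := DP n.
pose code (x : X) : set (nat * nat) :=
  [set nm | exists A, [/\ D nm.1 A, (set_val @` A) x & e nm.1 A = nm.2]].
apply: card_le_trans (card_set_count_le (nat * nat)%type).
apply/pcard_injP; exists code => x y /set_mem Lx /set_mem Ly /funeqP E.
(* Equal codes put [x] and [y] in a common trace of some [N (n, w)], whose square lies in [U n]. *)
apply: (Ud (x, y)) => n _.
have [DN _ Dcov] := DP n.
have [A DA Ax] : (\bigcup_(A in D n) A) (SigSub (mem_set Lx) : set_type L) by rewrite Dcov.
have : code y (n, e n A).
  by rewrite -E; exists A; split=> //; exists (SigSub (mem_set Lx)).
move=> [B [/= DB [z Bz zy] eBA]].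
have BA : B = A by apply: (eP n) => //; exact: mem_set.
subst B; have [w _ wA] := DN _ DA.
have [_ _] := NP (n, set_val w); apply; split => /=.
- by move: Ax; rewrite -wA.
- by rewrite -zy; move: Bz; rewrite -wA.
Qed.

(** By disjointness, choosing a point of [L] in each member is injective. *)
Lemma cellular_family_card_le {X : topologicalType} (U : set (set X)) (L : set X) :
  cellular_family U -> (forall A, U A -> A `&` L !=set0) ->
  L #<= [set: set nat] -> U #<= [set: set nat].
Proof.
move=> [_ _ tU] UL; apply: card_le_trans.
have [[A0 UA0]|/nonemptyPn ->] := pselect (U !=set0); last exact: card_ge0.
have [x0 _] := UL _ UA0.
have /choice[f fP] : forall A, exists x, U A -> A x /\ L x.
  move=> A; have [/UL[x]|nA] := pselect (U A); first by exists x.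
  by exists x0.
have fI : {in U &, injective f}.
  move=> A B /set_mem UA /set_mem UB fAB; apply: tU => //.
  by exists (f A); split; [have [] := fP A UA|rewrite fAB; have [] := fP B UB].
rewrite -(card_le_eql (inj_card_eq fI)); apply: subset_card_le => _ [A UA <-].
by have [] := fP A UA.
Qed.

(** * The reflection argument *)

Section RegularGdelta.
Context {X : topologicalType}.
Hypothesis cellX : forall U : set (set X), cellular_family U -> U #<= [set: set nat].
Variable U : nat -> set (X * X).
Hypothesis closureU : \bigcap_n closure (U n) `<=` diagonal.
Variable N : nat * X -> set X.
Hypothesis Nop : forall nx, open (N nx).
Hypothesis Nx : forall nx, N nx nx.2.
Hypothesis NN : forall nx, N nx `*` N nx `<=` U nx.1.

Let C n (A : set X) : set X := closure (\bigcup_(x in A) N (n, x)).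

Let openCC n A : open (~` C n A).
Proof. exact/closed_openC/closed_closure. Qed.

(* [Some n] reads two sets of points off the slots [(0, set0)] and [(1, set0)] of
   [h]; [None] reads off, for each [n], a family of sets of points, the empty
   ones marking unused slots. *)
Let reflected (i : option nat) (h : nat * set nat -> set X) : set X :=
  if i is Some n then
    [set r | ~ N (n, r) `<=` C n (h (0, set0)) /\
             ~ N (n, r) `<=` C n (h (1, set0))]
  else
    [set r | forall n,
       ~ closure (\bigcup_(k in [set k | h (n, k) !=set0]) ~` C n (h (n, k))) r].

Section Reflection.
Variable Y : set X.
Hypothesis reflectY : forall i h, (forall j, h j `<=` Y /\ h j #<= [set: set nat]) ->
  reflected i h !=set0 -> reflected i h `&` Y !=set0.

Lemma separate_from_reflecting_set (p q : X) : Y q -> q <> p ->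
  exists n A, [/\ A `<=` Y, A #<= [set: set nat], ~ C n A q & N (n, p) `<=` C n A].
Proof.
move=> Yq qp.
have [n nU] : exists n, ~ closure (U n) (q, p).
  apply: contrapT => /forallNP nU; apply: qp; apply: (closureU (q, p)) => n _.
  exact: contrapT (nU n).
have [G [H [Gop Hop Gq Hp GHU]]] := nclosure_prod _ _ _ nU.
have dense_part K : open K -> exists A : set X,
    [/\ A `<=` Y, A #<= [set: set nat], K `&` C n A = set0 &
        forall r, Y r -> N (n, r) `&` K = set0 -> N (n, r) `<=` C n A].
  move=> Kop.
  have [A [AR Ab Ad]] := small_dense_subfamily cellX (fun r => N (n, r))
    [set r | Y r /\ N (n, r) `&` K = set0] (fun r _ => Nop (n, r)).
  exists A; split=> //.
  - by move=> r /AR[].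
  - rewrite -subset0 => x [Kx /(_ K)].
    case=> [|y [[r /AR[_ NK] Ny] Ky]]; first exact: open_nbhs_nbhs.
    by have : (N (n, r) `&` K) y by []; rewrite NK.
  - by move=> r Yr NK x Nrx; apply: Ad; exists r.
have [A [AY Ab GA AN]] := dense_part G Gop.
have [B [BY Bb HB BN]] := dense_part H Hop.
exists n, A; split=> //.
  by move=> CAq; have : (G `&` C n A) q by []; rewrite GA.
pose h (j : nat * set nat) := if j.1 is 0 then A else B.
have [//|nA] := pselect (N (n, p) `<=` C n A).
have hY j : h j `<=` Y /\ h j #<= [set: set nat] by case: j => -[|j] k.
(* If [N (n, p)] is not inside [C n A], then [p] witnesses the condition for [Some n]: [H] contains
   [p] and misses [C n B]. *)
have [|r [[nrA nrB] Yr]] := reflectY (Some n) h hY.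
  exists p; split=> //= /(_ p (Nx (n, p))) CBp.
  by have : (H `&` C n B) p by []; rewrite HB.
have [NG|/eqP/set0P[g [Ng Gg]]] := pselect (N (n, r) `&` G = set0).
  by case: nrA; exact: AN.
case: nrB; apply: BN => //; rewrite -subset0 => y [Ny Hy].
have : (G `*` H `&` U n) (g, y) by split=> //; exact: NN (n, r) _ _.
by rewrite GHU.
Qed.

Lemma reflecting_setT : Y = [set: X].
Proof.
rewrite -subTset => p _; apply: contrapT => nYp.
pose family n := [set A | [/\ A `<=` Y, A #<= [set: set nat] & N (n, p) `<=` C n A]].
have /choice[g gP] : forall n, exists g : set nat -> set X,
    (forall k, g k !=set0 -> family n (g k)) /\
    (forall k, g k `<=` Y /\ g k #<= [set: set nat]) /\
    \bigcup_(A in family n) ~` C n A `<=`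
      closure (\bigcup_(k in [set k | g k !=set0]) ~` C n (g k)).
  move=> n.
  have [S [SR Sb Sd]] := small_dense_subfamily cellX (fun A => ~` C n A) (family n)
    (fun A _ => openCC n A).
  have [g [gS Sg]] := card_le_enum S set0 Sb.
  exists g; split; [|split].
  - by move=> k; case: (gS k) => [/SR//|->] [].
  - by move=> k; case: (gS k) => [/SR[]//|->]; split=> //; exact: card_ge0.
  - apply: subset_trans Sd _; apply: closureS => x [A SA nCx].
    have [k gk] := Sg _ SA; exists k; rewrite ?gk//=; rewrite gk.
    (* [C n A] contains [p], so [A] is non-empty and its slot counts as used. *)
    have [_ _ /(_ p (Nx (n, p))) /(_ setT filterT)[y [[a Aa _] _]]] := SR _ SA.
    by exists a.
pose h (j : nat * set nat) := g j.1 j.2.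
have hY j : h j `<=` Y /\ h j #<= [set: set nat] by have [_ [+ _]] := gP j.1; exact.
have [|q [hq Yq]] := reflectY None h hY.
  (* [N (n, p)] is a neighbourhood of [p] disjoint from all the sets in the union. *)
  exists p => n /(_ (N (n, p))) [|y [[k gk nCy] Ny]].
    by apply: open_nbhs_nbhs; split; [exact: Nop|exact: Nx].
  by have [/(_ k gk)[_ _ NC] _] := gP n; apply: nCy; exact: NC.
(* The reflected point [q] lies in [~ C n A] for some [A] in [family n], hence in the closure that
   it was to avoid. *)
have [|n [A [AY Ab nCq NC]]] := separate_from_reflecting_set p q Yq.
  by move=> qp; apply: nYp; rewrite -qp.
by apply: (hq n); have [_ [_]] := gP n; apply; exists A.
Qed.

End Reflection.

Lemma card_le_of_cellularity : [set: X] #<= [set: set (set nat)].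
Proof.
have [Y [Yb reflectY]] := exists_reflecting_set reflected (card_count_le _)
  (card_prod_le _ _ (card_count_le _) (card_lexx _)).
by rewrite -(reflecting_setT Y reflectY).
Qed.

End RegularGdelta.

Theorem theorem14 (X : topologicalType)
  (hausX : hausdorff_space X)
  (clX : cellular_lindelof X)
  (diagX : regular_Gdelta_diagonal X) :
  [set: X] #<= [set: set (set nat)].
Proof.
have [U [Uop dU Ucl]] := diagX.
have /choice[N NP] : forall nx : nat * X, exists V : set X,
    [/\ open V, V nx.2 & V `*` V `<=` U nx.1].
  by move=> [n x]; exact: open_diagonal_square.
apply: (card_le_of_cellularity _ U _ N); try by move=> nx; have [] := NP nx.
- move=> V cV; have [L [lindL VL]] := clX V cV.
  apply: cellular_family_card_le VL _ => //.
  apply: lindelof_card_le Uop dU _ lindL.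
  by rewrite Ucl => x Ux n _; apply: subset_closure; exact: Ux.
- by rewrite Ucl.
Qed.
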